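(* Let $\mathbb{C}$ be a regular category. The following conditions are equivalent: (i) $\mathbb{C}$ is a Mal'tsev category; (ii) the Shifting Lemma holds in $\mathbb{C}$ when $R$, $S$ and $T$ are reflexive relations; that is, for every object $X$ of $\mathbb{C}$ and all reflexive relations $R,S,T$ on $X$ with $R\wedge S\leqslant T$, whenever $x,y,u,v$ are (generalised) elements of $X$ with $(x,y)\in R\wedge T$, $(x,u)\in S$, $(y,v)\in S$ and $(u,v)\in R$, one has $(u,v)\in T$.
   Context: A category with finite limits is regular if every morphism factors as a regular epimorphism (a coequaliser of some parallel pair) followed by a monomorphism, and regular epimorphisms are stable under pullback. An (internal) relation $R$ from $X$ to $Y$ is a subobject $\langle r_1,r_2\rangle\colon R\rightarrowtail X\times Y$; a relation on $X$ is a relation from $X$ to $X$. For relations, $\leqslant$ denotes inclusion of subobjects and $\wedge$ denotes their intersection (meet of subobjects). For morphisms $x\colon A\to X$, $y\colon A\to Y$ with a common arbitrary domain $A$ (generalised elements), $(x,y)\in R$ means that $\langle x,y\rangle\colon A\to X\times Y$ factors through $R$. The opposite $R^\circ$ is the subobject $\langle r_2,r_1\rangle\colon R\rightarrowtail Y\times X$. For relations $R\rightarrowtail X\times Y$ and $S\rightarrowtail Y\times Z$ in a regular category, the composite $SR\rightarrowtail X\times Z$ (first $R$, then $S$) is the image, in the (regular epimorphism, monomorphism) factorization, of $\langle r_1\pi_1,s_2\pi_2\rangle\colon R\times_Y S\to X\times Z$, where $R\times_Y S$ is the pullback of $r_2$ and $s_1$. A relation $R$ on $X$ is reflexive if $1_X\leqslant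 R$, where $1_X$ is the diagonal $\langle 1_X,1_X\rangle\colon X\rightarrowtail X\times X$; symmetric if $R^\circ\leqslant R$; transitive if $RR\leqslant R$; and an equivalence relation if it is reflexive, symmetric and transitive. A finitely complete category $\mathbb{C}$ is a Mal'tsev category if every reflexive relation in $\mathbb{C}$ is an equivalence relation. *)

(* Defs.v *)
From Stdlib Require Import List Bool Eqdep_dec.
Import ListNotations.

Set Implicit Arguments.
Unset Strict Implicit.
Unset Printing Implicit Defensive.

(* Categories, with Leibniz equality of morphisms. *)

Record Category : Type := {
  Ob :> Type;
  Hom : Ob -> Ob -> Type;
  id : forall X, Hom X X;
  comp : forall X Y Z, Hom Y Z -> Hom X Y -> Hom X Z;
  comp_id_l : forall X Y (f : Hom X Y), comp (id Y) f = f;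
  comp_id_r : forall X Y (f : Hom X Y), comp f (id X) = f;
  comp_assoc : forall W X Y Z (h : Hom Y Z) (g : Hom X Y) (f : Hom W X),
    comp h (comp g f) = comp (comp h g) f }.

Arguments id {c} X.

Declare Scope cat_scope.
Delimit Scope cat_scope with cat.
Open Scope cat_scope.
Notation "g ∘ f" := (comp g f) (at level 40, left associativity) : cat_scope.

Definition monic (C : Category) (X Y : C) (m : Hom X Y) : Prop :=
  forall (A : C) (f g : Hom A X), m ∘ f = m ∘ g -> f = g.

Definition is_coequaliser (C : Category) (W X Q : C)
    (g h : Hom W X) (q : Hom X Q) : Prop :=
  q ∘ g = q ∘ h /\
  forall (Z : C) (f : Hom X Z), f ∘ g = f ∘ h -> exists! k : Hom Q Z, k ∘ q = f.

Definition regular_epi (C : Category) (X Q : C) (q : Hom X Q) : Prop :=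
  exists (W : C) (g h : Hom W X), is_coequaliser g h q.

Record Functor (J C : Category) : Type := {
  fobj :> J -> C;
  fmap : forall i j : J, Hom i j -> Hom (fobj i) (fobj j);
  fmap_id : forall i : J, fmap (id i) = id (fobj i);
  fmap_comp : forall (i j k : J) (b : Hom j k) (a : Hom i j),
    fmap (b ∘ a) = fmap b ∘ fmap a }.

Record Cone (J C : Category) (D : Functor J C) : Type := {
  vertex : C;
  leg : forall j : J, Hom vertex (D j);
  leg_natural : forall (i j : J) (a : Hom i j), fmap D a ∘ leg i = leg j }.

(* The mediating morphism is part of the data, so that pairings <x, y> are
   available as morphisms. *)
Record Limit (J C : Category) (D : Functor J C) : Type := {
  limit_cone :> Cone D;
  lift : forall K : Cone D, Hom (vertex K) (vertex limit_cone);
  lift_leg : forall (K : Cone D) (j : J), leg limit_cone j ∘ lift K = leg K j;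
  lift_unique : forall (K : Cone D) (h : Hom (vertex K) (vertex limit_cone)),
    (forall j : J, leg limit_cone j ∘ h = leg K j) -> h = lift K }.

Definition finite_type (A : Type) : Prop := exists l : list A, forall a, In a l.

Definition finite_category (J : Category) : Prop :=
  finite_type J /\ forall i j : J, finite_type (Hom i j).

Definition FiniteLimits (C : Category) : Type :=
  forall J : Category, finite_category J -> forall D : Functor J C, Limit D.

Lemma limit_jointly_monic (J C : Category) (D : Functor J C) (L : Limit D)
    (A : C) (f g : Hom A (vertex L)) :
  (forall j, leg L j ∘ f = leg L j ∘ g) -> f = g.
Proof.
intros H.
assert (nat : forall i j (a : Hom i j), fmap D a ∘ (leg L i ∘ g) = leg L j ∘ g).
{ intros i j a; rewrite comp_assoc, leg_natural; reflexivity. }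
set (K := Build_Cone nat).
transitivity (lift L K).
- exact (@lift_unique J C D L K f H).
- symmetry; exact (@lift_unique J C D L K g (fun j => eq_refl)).
Qed.

Lemma finite_bool_eq (a b : bool) : finite_type (a = b).
Proof.
destruct (bool_dec a b) as [e | n].
- exists [e]; intros e'; left; apply UIP_dec, bool_dec.
- exists []; intros e; contradiction.
Qed.

(* Binary products: limits over the discrete category on two objects. *)

Definition pair_shape : Category.
Proof.
refine {| Ob := bool;
          Hom := fun i j => i = j;
          id := fun i => eq_refl;
          comp := fun i j k b a => eq_trans a b |}.
- intros i j []; reflexivity.
- intros i j []; reflexivity.
- intros i j k l [] [] []; reflexivity.
Defined.

Lemma finite_pair_shape : finite_category pair_shape.
Proof.
split.
- exists [true; false]; intros []; simpl; auto.
- exact finite_bool_eq.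
Qed.

Definition pair_diagram (C : Category) (X Y : C) : Functor pair_shape C.
Proof.
refine {| fobj := fun i : pair_shape => if i then X else Y;
          fmap := fun i j (a : @Hom pair_shape i j) =>
            match a in _ = j return Hom (if i then X else Y) (if j then X else Y)
            with eq_refl => id _ end |}.
- reflexivity.
- intros i j k [] []; simpl; symmetry; apply comp_id_l.
Defined.

Definition pair_cone (C : Category) (X Y A : C) (x : Hom A X) (y : Hom A Y) :
  Cone (pair_diagram X Y).
Proof.
refine (@Build_Cone pair_shape C (pair_diagram X Y) A
  (fun i : bool => if i return Hom A (if i then X else Y) then x else y) _).
intros i j []; apply comp_id_l.
Defined.

(* Pullbacks: limits over the poset cospan_left <= cospan_apex >= cospan_right.
   Hom i j is the proposition i <= j, stated as a boolean equation so that it is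
   proof-irrelevant. *)

Inductive cospan_ob : Set := cospan_left | cospan_right | cospan_apex.

Definition cospan_le (i j : cospan_ob) : bool :=
  match i, j with
  | _, cospan_apex | cospan_left, cospan_left | cospan_right, cospan_right => true
  | _, _ => false
  end.

Lemma cospan_le_refl i : cospan_le i i = true.
Proof. destruct i; reflexivity. Qed.

Lemma cospan_le_trans i j k :
  cospan_le j k = true -> cospan_le i j = true -> cospan_le i k = true.
Proof. destruct i, j, k; simpl; congruence. Qed.

Definition cospan_shape : Category.
Proof.
refine {| Ob := cospan_ob;
          Hom := fun i j => cospan_le i j = true;
          id := cospan_le_refl;
          comp := cospan_le_trans |};
  intros; apply UIP_dec, bool_dec.
Defined.

Lemma finite_cospan_shape : finite_category cospan_shape.
Proof.
split.
- exists [cospan_left; cospan_right; cospan_apex]; intros []; simpl; auto.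
- intros i j; apply finite_bool_eq.
Qed.

Section Cospan.
Variables (C : Category) (X Y Z : C) (f : Hom X Z) (g : Hom Y Z).

Definition cospan_fobj (i : cospan_ob) : C :=
  match i with cospan_left => X | cospan_right => Y | cospan_apex => Z end.

Definition cospan_fmap (i j : cospan_ob) :
    cospan_le i j = true -> Hom (cospan_fobj i) (cospan_fobj j) :=
  match i, j
    return cospan_le i j = true -> Hom (cospan_fobj i) (cospan_fobj j) with
  | cospan_left, cospan_left => fun _ => id X
  | cospan_right, cospan_right => fun _ => id Y
  | cospan_apex, cospan_apex => fun _ => id Z
  | cospan_left, cospan_apex => fun _ => f
  | cospan_right, cospan_apex => fun _ => g
  | _, _ => fun e => False_rect _ (diff_false_true e)
  end.

Definition cospan_diagram : Functor cospan_shape C.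
Proof.
refine {| fobj := cospan_fobj : cospan_shape -> C; fmap := cospan_fmap |}.
- intros []; reflexivity.
- intros [] [] [] b a; try discriminate b; try discriminate a; simpl;
    rewrite ?comp_id_l, ?comp_id_r; reflexivity.
Defined.

Definition Pullback : Type := Limit cospan_diagram.

Definition pb1 (P : Pullback) : Hom (vertex P) X := leg P cospan_left.
Definition pb2 (P : Pullback) : Hom (vertex P) Y := leg P cospan_right.

Lemma pb_square (P : Pullback) : f ∘ pb1 P = g ∘ pb2 P.
Proof.
transitivity (leg P cospan_apex).
- exact (leg_natural P (i := cospan_left) (j := cospan_apex) eq_refl).
- symmetry; exact (leg_natural P (i := cospan_right) (j := cospan_apex) eq_refl).
Qed.

Lemma pb_jointly_monic (P : Pullback) (A : C) (h k : Hom A (vertex P)) :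
  pb1 P ∘ h = pb1 P ∘ k -> pb2 P ∘ h = pb2 P ∘ k -> h = k.
Proof.
intros H1 H2; apply limit_jointly_monic; intros []; trivial.
rewrite <- (leg_natural P (i := cospan_left) (j := cospan_apex) eq_refl).
rewrite <- !comp_assoc; exact (f_equal (comp f) H1).
Qed.

End Cospan.

(* Regular categories. *)

Record Factorisation (C : Category) (X Y : C) (f : Hom X Y) : Type := {
  im : C;
  im_epi : Hom X im;
  im_mono : Hom im Y;
  im_epi_regular : regular_epi im_epi;
  im_mono_monic : monic im_mono;
  im_comp : im_mono ∘ im_epi = f }.

Record RegularCategory : Type := {
  reg_cat :> Category;
  finite_limits : FiniteLimits reg_cat;
  factorisation : forall (X Y : reg_cat) (f : Hom X Y), Factorisation f;
  regular_epi_stable :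
    forall (X Y Z : reg_cat) (f : Hom X Z) (g : Hom Y Z) (P : Pullback f g),
    regular_epi f -> regular_epi (pb2 P) }.

Section Relations.
Variable C : RegularCategory.

Definition product (X Y : C) : Limit (pair_diagram X Y) :=
  finite_limits finite_pair_shape (pair_diagram X Y).

Definition prod (X Y : C) : C := vertex (product X Y).
Definition pr1 (X Y : C) : Hom (prod X Y) X := leg (product X Y) true.
Definition pr2 (X Y : C) : Hom (prod X Y) Y := leg (product X Y) false.
Definition pairing (X Y A : C) (x : Hom A X) (y : Hom A Y) : Hom A (prod X Y) :=
  lift (product X Y) (pair_cone x y).

Lemma pr1_pairing (X Y A : C) (x : Hom A X) (y : Hom A Y) :
  pr1 X Y ∘ pairing x y = x.
Proof. exact (lift_leg (product X Y) (pair_cone x y) true). Qed.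

Lemma pr2_pairing (X Y A : C) (x : Hom A X) (y : Hom A Y) :
  pr2 X Y ∘ pairing x y = y.
Proof. exact (lift_leg (product X Y) (pair_cone x y) false). Qed.

Lemma prod_jointly_monic (X Y A : C) (h k : Hom A (prod X Y)) :
  pr1 X Y ∘ h = pr1 X Y ∘ k -> pr2 X Y ∘ h = pr2 X Y ∘ k -> h = k.
Proof. intros H1 H2; apply limit_jointly_monic; intros []; trivial. Qed.

Definition pullback (X Y Z : C) (f : Hom X Z) (g : Hom Y Z) : Pullback f g :=
  finite_limits finite_cospan_shape (cospan_diagram f g).

(* A relation is represented by a monomorphism into the product; the subobject
   itself is its class under mutual inclusion, see rel_le. *)
Record Relation (X Y : C) : Type := {
  rel_ob : C;
  rel_mor : Hom rel_ob (prod X Y);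
  rel_monic : monic rel_mor }.

Definition rel1 (X Y : C) (R : Relation X Y) : Hom (rel_ob R) X :=
  pr1 X Y ∘ rel_mor R.
Definition rel2 (X Y : C) (R : Relation X Y) : Hom (rel_ob R) Y :=
  pr2 X Y ∘ rel_mor R.

Definition rel_le (X Y : C) (R S : Relation X Y) : Prop :=
  exists k : Hom (rel_ob R) (rel_ob S), rel_mor S ∘ k = rel_mor R.

Definition rel_mem (X Y A : C) (x : Hom A X) (y : Hom A Y) (R : Relation X Y) :
    Prop :=
  exists k : Hom A (rel_ob R), rel_mor R ∘ k = pairing x y.

Definition rel_meet (X Y : C) (R S : Relation X Y) : Relation X Y.
Proof.
refine {| rel_ob := vertex (pullback (rel_mor R) (rel_mor S));
          rel_mor := rel_mor R ∘ pb1 (pullback (rel_mor R) (rel_mor S)) |}.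
intros A h k H; rewrite <- !comp_assoc in H; apply rel_monic in H.
apply pb_jointly_monic; [exact H |].
apply (rel_monic (r := S)); rewrite !comp_assoc, <- !pb_square, <- !comp_assoc, H.
reflexivity.
Defined.

Definition rel_diag (X : C) : Relation X X.
Proof.
refine {| rel_ob := X; rel_mor := pairing (id X) (id X) |}.
intros A h k H; apply (f_equal (comp (pr1 X X))) in H.
rewrite !comp_assoc, !pr1_pairing, !comp_id_l in H; exact H.
Defined.

Definition rel_op (X Y : C) (R : Relation X Y) : Relation Y X.
Proof.
refine {| rel_ob := rel_ob R; rel_mor := pairing (rel2 R) (rel1 R) |}.
intros A h k H; apply (rel_monic (r := R)); apply prod_jointly_monic.
- apply (f_equal (comp (pr2 Y X))) in H.
  rewrite !comp_assoc, !pr2_pairing in H; rewrite !comp_assoc; exact H.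
- apply (f_equal (comp (pr1 Y X))) in H.
  rewrite !comp_assoc, !pr1_pairing in H; rewrite !comp_assoc; exact H.
Defined.

(* rel_comp S R is the composite S R: first R, then S. *)
Definition rel_comp (X Y Z : C) (S : Relation Y Z) (R : Relation X Y) :
    Relation X Z :=
  let P := pullback (rel2 R) (rel1 S) in
  let F := factorisation (pairing (rel1 R ∘ pb1 P) (rel2 S ∘ pb2 P)) in
  {| rel_ob := im F; rel_mor := im_mono F; rel_monic := @im_mono_monic _ _ _ _ F |}.

Definition reflexive (X : C) (R : Relation X X) : Prop := rel_le (rel_diag X) R.
Definition symmetric (X : C) (R : Relation X X) : Prop := rel_le (rel_op R) R.
Definition transitive (X : C) (R : Relation X X) : Prop := rel_le (rel_comp R R) R.

Definition equivalence_relation (X : C) (R : Relation X X) : Prop :=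
  reflexive R /\ symmetric R /\ transitive R.

Definition maltsev : Prop :=
  forall (X : C) (R : Relation X X), reflexive R -> equivalence_relation R.

End Relations.

Notation "R ≤ S" := (rel_le R S) (at level 70, no associativity) : cat_scope.
Notation "R ∧ S" := (rel_meet R S) (at level 60, right associativity) : cat_scope.
Notation "⟨ x , y ⟩ ∈ R" := (rel_mem x y R)
  (at level 70, no associativity, x at level 60, y at level 60) : cat_scope.

Arguments maltsev C : clear implicits.

(* Main.v *)
Require Import Defs.
Set Implicit Arguments.
Unset Strict Implicit.

(** Everything is computed with generalised elements, as if the objects were
    sets.  The one difference is that an element of a composite relation has a
    middle point only after restriction along a regular epimorphism
    ([rel_mem_comp_elim]); this is harmless because membership in a relation
    descends along regular epimorphisms ([rel_mem_descent]).

    From Mal'tsev to the Shifting Lemma: put W = R ∧ T.  The composite W S is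
    reflexive, hence symmetric, and it contains (u, y) because u S x W y.  So it
    contains (y, u): there is a point z with y S z W u.  It completes the fourth
    corner of the rectangle.  Since z R u R v and z S y S v, the pair (z, v) lies
    in R ∧ S ≤ T, and u T z T v gives u T v.

    From the Shifting Lemma to Mal'tsev: for a reflexive relation E, use the
    lemma with R the total relation and S = T = E.  The hypothesis R ∧ S ≤ T is
    then trivial, and the lemma says that E is closed under translation along
    itself: if x E y, x E u and y E v, then u E v.  The degenerate rectangle
    x = y = v gives symmetry; once E is symmetric, the rectangle y = v, in which
    x E u may be read as u E x, gives transitivity. *)

(** * Pairings, pullbacks and regular epimorphisms *)

Section Elements.
Variable C : RegularCategory.

Lemma pairing_comp (X Y A B : C) (x : Hom A X) (y : Hom A Y) (f : Hom B A) :
  pairing x y ∘ f = pairing (x ∘ f) (y ∘ f).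
Proof.
apply prod_jointly_monic.
- rewrite comp_assoc, !pr1_pairing; reflexivity.
- rewrite comp_assoc, !pr2_pairing; reflexivity.
Qed.

Lemma pairing_eta (X Y A : C) (h : Hom A (prod X Y)) :
  pairing (pr1 X Y ∘ h) (pr2 X Y ∘ h) = h.
Proof. apply prod_jointly_monic; [apply pr1_pairing | apply pr2_pairing]. Qed.

Lemma pullback_lift (X Y Z : C) (f : Hom X Z) (g : Hom Y Z) (P : Pullback f g)
    (A : C) (a : Hom A X) (b : Hom A Y) :
  f ∘ a = g ∘ b -> exists h : Hom A (vertex P), pb1 P ∘ h = a /\ pb2 P ∘ h = b.
Proof.
intros H.
pose (l := fun i : cospan_shape =>
  match i return Hom A (cospan_fobj X Y Z i) with
  | cospan_left => a
  | cospan_right => b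
  | cospan_apex => f ∘ a
  end).
assert (nat : forall i j (e : Hom i j), fmap (cospan_diagram f g) e ∘ l i = l j).
{ intros [] [] e; try discriminate e; simpl; rewrite ?comp_id_l; auto. }
exists (lift P (Build_Cone nat)); split.
- exact (lift_leg P (Build_Cone nat) cospan_left).
- exact (lift_leg P (Build_Cone nat) cospan_right).
Qed.

(** Regular epimorphisms are strong: since [m] is monic, [f] coequalises
    whatever [q] coequalises, so it factors through [q], and [q] is epic. *)
Lemma regular_epi_strong (A B M Y : C) (q : Hom B A) (m : Hom M Y)
    (f : Hom B M) (g : Hom A Y) :
  regular_epi q -> monic m -> m ∘ f = g ∘ q -> exists k : Hom A M, m ∘ k = g.
Proof.
intros (W & a & b & Hab & univ) Hm H.
assert (Hf : f ∘ a = f ∘ b).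
{ apply Hm; rewrite !comp_assoc, H, <- !comp_assoc, Hab; reflexivity. }
destruct (univ _ f Hf) as (k & Hk & _); exists k.
assert (Hg : g ∘ q ∘ a = g ∘ q ∘ b).
{ rewrite <- !comp_assoc, Hab; reflexivity. }
destruct (univ _ (g ∘ q) Hg) as (k' & _ & uniq).
transitivity k'.
- symmetry; apply uniq; rewrite <- comp_assoc, Hk; exact H.
- apply uniq; reflexivity.
Qed.

(** * Membership of generalised elements in relations *)

Lemma rel_mem_precomp (X Y A B : C) (x : Hom A X) (y : Hom A Y) (f : Hom B A)
    (R : Relation X Y) :
  ⟨x, y⟩ ∈ R -> ⟨x ∘ f, y ∘ f⟩ ∈ R.
Proof.
intros [k Hk]; exists (k ∘ f); rewrite comp_assoc, Hk; apply pairing_comp.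
Qed.

Lemma rel_mem_descent (X Y A B : C) (x : Hom A X) (y : Hom A Y) (q : Hom B A)
    (R : Relation X Y) :
  regular_epi q -> ⟨x ∘ q, y ∘ q⟩ ∈ R -> ⟨x, y⟩ ∈ R.
Proof.
intros Hq [k Hk]; rewrite <- pairing_comp in Hk.
exact (regular_epi_strong Hq (rel_monic (r := R)) Hk).
Qed.

Lemma rel_le_mem (X Y A : C) (x : Hom A X) (y : Hom A Y) (R S : Relation X Y) :
  R ≤ S -> ⟨x, y⟩ ∈ R -> ⟨x, y⟩ ∈ S.
Proof.
intros [i Hi] [k Hk]; exists (i ∘ k); rewrite comp_assoc, Hi; exact Hk.
Qed.

Lemma rel_mem_proj (X Y A : C) (R : Relation X Y) (k : Hom A (rel_ob R)) :
  ⟨rel1 R ∘ k, rel2 R ∘ k⟩ ∈ R.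
Proof.
exists k; unfold rel1, rel2; rewrite <- !comp_assoc, pairing_eta; reflexivity.
Qed.

(** Inclusion only has to be tested on the generic element, namely the pair of
    projections of the relation itself. *)
Lemma rel_le_intro (X Y : C) (R S : Relation X Y) :
  (forall (A : C) (x : Hom A X) (y : Hom A Y), ⟨x, y⟩ ∈ R -> ⟨x, y⟩ ∈ S) ->
  R ≤ S.
Proof.
intros H; destruct (H _ (rel1 R) (rel2 R)) as [k Hk].
- exists (id _); rewrite comp_id_r; symmetry; apply pairing_eta.
- exists k; rewrite Hk; apply pairing_eta.
Qed.

Lemma rel_mem_meet (X Y A : C) (x : Hom A X) (y : Hom A Y) (R S : Relation X Y) :
  ⟨x, y⟩ ∈ R ∧ S <-> ⟨x, y⟩ ∈ R /\ ⟨x, y⟩ ∈ S.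
Proof.
split.
- intros [k Hk]; cbn in Hk; split.
  + exists (pb1 _ ∘ k); rewrite comp_assoc; exact Hk.
  + exists (pb2 _ ∘ k); rewrite comp_assoc, <- pb_square; exact Hk.
- intros [[k Hk] [l Hl]].
  assert (H : rel_mor R ∘ k = rel_mor S ∘ l) by congruence.
  destruct (pullback_lift (pullback (rel_mor R) (rel_mor S)) H) as (h & H1 & _).
  exists h; cbn; rewrite <- comp_assoc, H1; exact Hk.
Qed.

Lemma rel_mem_op (X Y A : C) (x : Hom A X) (y : Hom A Y) (R : Relation X Y) :
  ⟨y, x⟩ ∈ rel_op R <-> ⟨x, y⟩ ∈ R.
Proof.
unfold rel_mem; cbn; split; intros [k Hk]; exists k.
- rewrite pairing_comp in Hk; apply prod_jointly_monic.
  + rewrite pr1_pairing, <- (pr2_pairing y x), <- Hk, pr2_pairing.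
    apply comp_assoc.
  + rewrite pr2_pairing, <- (pr1_pairing y x), <- Hk, pr1_pairing.
    apply comp_assoc.
- unfold rel1, rel2; rewrite pairing_comp, <- !comp_assoc, Hk.
  rewrite pr1_pairing, pr2_pairing; reflexivity.
Qed.

Lemma rel_mem_comp_intro (X Y Z A : C) (x : Hom A X) (y : Hom A Y) (z : Hom A Z)
    (R : Relation X Y) (S : Relation Y Z) :
  ⟨x, y⟩ ∈ R -> ⟨y, z⟩ ∈ S -> ⟨x, z⟩ ∈ rel_comp S R.
Proof.
intros [k Hk] [l Hl].
assert (H : rel2 R ∘ k = rel1 S ∘ l).
{ unfold rel1, rel2; rewrite <- !comp_assoc, Hk, Hl, pr1_pairing, pr2_pairing.
  reflexivity. }
destruct (pullback_lift (pullback (rel2 R) (rel1 S)) H) as (h & H1 & H2).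
unfold rel_mem, rel_comp; cbn.
set (F := factorisation _); exists (im_epi F ∘ h).
rewrite comp_assoc, im_comp, pairing_comp, <- !comp_assoc, H1, H2.
unfold rel1, rel2; rewrite <- !comp_assoc, Hk, Hl, pr1_pairing, pr2_pairing.
reflexivity.
Qed.

(** The cover [q] is the pullback, along the given element, of the regular
    epimorphism onto the image that defines the composite. *)
Lemma rel_mem_comp_elim (X Y Z A : C) (x : Hom A X) (z : Hom A Z)
    (R : Relation X Y) (S : Relation Y Z) :
  ⟨x, z⟩ ∈ rel_comp S R ->
  exists (B : C) (q : Hom B A) (y : Hom B Y),
    regular_epi q /\ ⟨x ∘ q, y⟩ ∈ R /\ ⟨y, z ∘ q⟩ ∈ S.
Proof.
unfold rel_mem at 1, rel_comp; cbn.
set (P := pullback (rel2 R) (rel1 S)); set (F := factorisation _).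
intros [k Hk]; pose (Q := pullback (im_epi F) k).
assert (H : pairing (rel1 R ∘ pb1 P ∘ pb1 Q) (rel2 S ∘ pb2 P ∘ pb1 Q)
          = pairing (x ∘ pb2 Q) (z ∘ pb2 Q)).
{ rewrite <- !pairing_comp, <- Hk.
  transitivity (im_mono F ∘ im_epi F ∘ pb1 Q).
  - rewrite im_comp; reflexivity.
  - rewrite <- !comp_assoc, pb_square; reflexivity. }
exists (vertex Q), (pb2 Q), (rel2 R ∘ pb1 P ∘ pb1 Q); split; [| split].
- apply regular_epi_stable, im_epi_regular.
- rewrite <- (pr1_pairing (x ∘ pb2 Q) (z ∘ pb2 Q)), <- H, pr1_pairing.
  rewrite <- !comp_assoc; apply rel_mem_proj.
- rewrite (pb_square P).
  rewrite <- (pr2_pairing (x ∘ pb2 Q) (z ∘ pb2 Q)), <- H, pr2_pairing.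
  rewrite <- !comp_assoc; apply rel_mem_proj.
Qed.

Definition rel_total (X Y : C) : Relation X Y :=
  {| rel_ob := prod X Y; rel_mor := id (prod X Y);
     rel_monic := fun A h k (H : id _ ∘ h = id _ ∘ k) =>
       eq_trans (eq_sym (comp_id_l h)) (eq_trans H (comp_id_l k)) |}.

Lemma rel_mem_total (X Y A : C) (x : Hom A X) (y : Hom A Y) :
  ⟨x, y⟩ ∈ rel_total X Y.
Proof. exists (pairing x y); apply comp_id_l. Qed.

(** * Relations on an object, elementwise *)

Section Endorelation.
Variables (X : C) (R : Relation X X).

Lemma reflexive_iff_mem :
  reflexive R <-> (forall (A : C) (x : Hom A X), ⟨x, x⟩ ∈ R).
Proof.
split.
- intros HR A x; apply (rel_le_mem HR); exists x; cbn.
  rewrite pairing_comp, comp_id_l; reflexivity.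
- intros H; exact (H _ (id X)).
Qed.

Lemma symmetric_iff_mem :
  symmetric R <-> (forall (A : C) (x y : Hom A X), ⟨x, y⟩ ∈ R -> ⟨y, x⟩ ∈ R).
Proof.
split.
- intros HR A x y H; apply (rel_le_mem HR), rel_mem_op; exact H.
- intros H; apply rel_le_intro; intros A x y Hxy; apply H, rel_mem_op, Hxy.
Qed.

Lemma transitive_iff_mem :
  transitive R <-> (forall (A : C) (x y z : Hom A X),
    ⟨x, y⟩ ∈ R -> ⟨y, z⟩ ∈ R -> ⟨x, z⟩ ∈ R).
Proof.
split.
- intros HR A x y z Hxy Hyz.
  exact (rel_le_mem HR (rel_mem_comp_intro Hxy Hyz)).
- intros H; apply rel_le_intro; intros A x z Hxz.
  destruct (rel_mem_comp_elim Hxz) as (B & q & y & Hq & Hxy & Hyz).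
  exact (rel_mem_descent Hq (H _ _ _ _ Hxy Hyz)).
Qed.

End Endorelation.

Lemma reflexive_meet (X : C) (R S : Relation X X) :
  reflexive R -> reflexive S -> reflexive (R ∧ S).
Proof. rewrite !reflexive_iff_mem; intros; apply rel_mem_meet; auto. Qed.

Lemma reflexive_comp (X : C) (R S : Relation X X) :
  reflexive R -> reflexive S -> reflexive (rel_comp S R).
Proof.
rewrite !reflexive_iff_mem; intros HR HS A x.
exact (rel_mem_comp_intro (HR A x) (HS A x)).
Qed.

(** Reflexive relations permute in a Mal'tsev category: [rel_comp S R] is
    symmetric, so its elements can be read backwards. *)
Lemma maltsev_permute (X : C) (R S : Relation X X) (A : C) (x y z : Hom A X) :
  maltsev C -> reflexive R -> reflexive S -> ⟨x, y⟩ ∈ R -> ⟨y, z⟩ ∈ S ->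
  exists (B : C) (q : Hom B A) (w : Hom B X),
    regular_epi q /\ ⟨z ∘ q, w⟩ ∈ R /\ ⟨w, x ∘ q⟩ ∈ S.
Proof.
intros HC HR HS Hxy Hyz.
destruct (HC X _ (reflexive_comp HR HS)) as (_ & Hsym & _).
apply rel_mem_comp_elim.
exact (proj1 (symmetric_iff_mem _) Hsym _ _ _ (rel_mem_comp_intro Hxy Hyz)).
Qed.

(** The closure condition is what the Shifting Lemma says when the relation
    playing the role of [R] is total and the other two are equal to [E]. *)
Lemma equivalence_relation_of_translation (X : C) (E : Relation X X) :
  reflexive E ->
  (forall (A : C) (x y u v : Hom A X),
     ⟨x, y⟩ ∈ E -> ⟨x, u⟩ ∈ E -> ⟨y, v⟩ ∈ E -> ⟨u, v⟩ ∈ E) ->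
  equivalence_relation E.
Proof.
intros HE shift; pose proof (proj1 (reflexive_iff_mem E) HE) as refl.
assert (sym : forall (A : C) (x y : Hom A X), ⟨x, y⟩ ∈ E -> ⟨y, x⟩ ∈ E).
{ intros A x y Hxy; exact (shift A x x y x (refl _ _) Hxy (refl _ _)). }
split; [exact HE | split].
- apply symmetric_iff_mem; exact sym.
- apply transitive_iff_mem; intros A x y z Hxy Hyz.
  exact (shift A y z x z Hyz (sym _ _ _ Hxy) (refl _ _)).
Qed.

End Elements.

(** * The Shifting Lemma for reflexive relations *)

Theorem theorem2p2 (C : RegularCategory) :
  maltsev C <->
  (forall (X : C) (R S T : Relation X X),
     reflexive R -> reflexive S -> reflexive T ->
     R ∧ S ≤ T ->
     forall (A : C) (x y u v : Hom A X),
       ⟨x, y⟩ ∈ R ∧ T -> ⟨x, u⟩ ∈ S -> ⟨y, v⟩ ∈ S -> ⟨u, v⟩ ∈ R ->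
       ⟨u, v⟩ ∈ T).
Proof.
split.
- intros HC X R S T HR HS HT HRST A x y u v Hxy Hxu Hyv Huv.
  destruct (HC X R HR) as (_ & Rsym & Rtrans).
  destruct (HC X S HS) as (_ & Ssym & Strans).
  destruct (HC X T HT) as (_ & Tsym & Ttrans).
  rewrite symmetric_iff_mem in Rsym, Ssym, Tsym.
  rewrite transitive_iff_mem in Rtrans, Strans, Ttrans.
  destruct (maltsev_permute HC HS (reflexive_meet HR HT) (Ssym _ _ _ Hxu) Hxy)
    as (B & q & z & Hq & Hyz & Hzu).
  apply rel_mem_meet in Hzu; destruct Hzu as [HzuR HzuT].
  apply (rel_mem_descent Hq).
  assert (Hzv : ⟨z, v ∘ q⟩ ∈ T).
  { apply (rel_le_mem HRST), rel_mem_meet; split.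
    - exact (Rtrans _ _ _ _ HzuR (rel_mem_precomp q Huv)).
    - exact (Strans _ _ _ _ (Ssym _ _ _ Hyz) (rel_mem_precomp q Hyv)). }
  exact (Ttrans _ _ _ _ (Tsym _ _ _ HzuT) Hzv).
- intros shifting X E HE; apply (equivalence_relation_of_translation HE).
  intros A x y u v Hxy Hxu Hyv.
  apply (shifting X (rel_total X X) E E) with (x := x) (y := y); trivial.
  + apply reflexive_iff_mem; intros; apply rel_mem_total.
  + apply rel_le_intro; intros B a b H; apply rel_mem_meet in H; apply H.
  + apply rel_mem_meet; split; [apply rel_mem_total | exact Hxy].
  + apply rel_mem_total.
Qed.
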